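(* Let $R$ be an associative ring with unit, let $M$ be a (left) $R$-module and let $N$ be a right $R$-module. Then there is an isomorphism of abelian groups, natural in $M$ and $N$, $$\mathrm{Hom}_{\mathcal R}(\mathcal M^*,\mathcal N)=\overline{\mathcal N}(M),$$ where $\mathrm{Hom}_{\mathcal R}$ denotes the morphisms of right $\mathcal R$-modules and $\overline{\mathcal N}$ is the extension of $\mathcal N$ to the category of $R$-modules.
   Context: ''$R$-module'' means left $R$-module. An $R$-algebra is an associative unital ring $S$ together with a unital ring homomorphism $R\to S$ (the image is not assumed to be central); morphisms are ring homomorphisms compatible with the maps from $R$. A (left, resp. right) $\mathcal R$-module is a covariant functor $\mathbb M$ from $R$-algebras to abelian groups together with a left (resp. right) $S$-module structure on $\mathbb M(S)$ for every $R$-algebra $S$, functorial in $S$ (i.e. the actions form a morphism of functors of sets, where $\mathcal R(S):=S$). Morphisms of $\mathcal R$-modules are morphisms of functors that are $S$-linear for every $S$. $\mathbb M_{|S}$ is the restriction of $\mathbb M$ to $S$-algebras. $\mathcal M$ is the left $\mathcal R$-module $\mathcal M(S)=S\otimes_RM$, and $\mathcal N$ is the right $\mathcal R$-module $\mathcal N(S)=N\otimes_RS$. The dual $\mathcal M^*$ is the right $\mathcal R$-module $\mathcal M^*(S):=\mathrm{Hom}_{\mathcal S}(\mathcal M_{|S},\mathcal S)$ (morphisms of left $\mathcal S$-modules on $S$-algebras, where $\mathcal S(T)=T$), with right $S$-action induced by right multiplication on $\mathcal S$; one has $\mathcal M^*(S)=\mathrm{Hom}_S(S\otimes_RM,S)=\mathrm{Hom}_R(M,S)$.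 For an $R$-module $M$, $R\langle M\rangle:=T^\cdot_R(M\otimes_{\mathbb Z}R)=(T^\cdot_{\mathbb Z}M)\otimes_{\mathbb Z}R=\bigoplus_{n\ge 0}M^{\otimes_{\mathbb Z}n}\otimes_{\mathbb Z}R$ is the tensor $R$-algebra of the $R$-bimodule $M\otimes_{\mathbb Z}R$. Writing $m_1\cdots m_n\cdot r$ for $m_1\otimes\cdots\otimes m_n\otimes r$, its product is $(m_1\cdots m_n\cdot r)(m_1'\cdots m_{n'}'\cdot r')=m_1\cdots m_n\cdot(rm_1')\cdot m_2'\cdots m'_{n'}\cdot r'$. An element $m\in M$ is identified with $m\otimes 1\in R\langle M\rangle$; an $R$-linear map from $M$ to an $R$-algebra $S$ extends uniquely to an $R$-algebra morphism $R\langle M\rangle\to S$. $M\oplus Rx$ denotes $M\oplus R$, with $x$ the generator of the second summand. Let $h_x\colon R\langle M\oplus Rx\rangle\to R\langle M\oplus Rx\rangle$ be the $R$-algebra morphism with $h_x(m)=m\cdot x$ for $m\in M$ and $h_x(x)=x$. The extension of a right $\mathcal R$-module $\mathbb F$ is the functor $\overline{\mathbb F}$ from $R$-modules to abelian groups given by $$\overline{\mathbb F}(M):=\mathrm{Ker}\big[\mathbb F(R\langle M\rangle)\to\mathbb F(R\langle M\oplus Rx\rangle),\ f\mapsto\mathbb F(h_x)(f)-f\cdot x\big],$$ where on the right $f$ also denotes its image in $\mathbb F(R\langle M\oplus Rx\rangle)$ under the map induced by $M\subseteq M\oplus Rx$. For an $R$-linear $w\colon M\to M'$, $\overline{\mathbb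 F}(w)$ is the restriction of $\mathbb F(\tilde w)$, where $\tilde w\colon R\langle M\rangle\to R\langle M'\rangle$ is the $R$-algebra morphism with $\tilde w(m)=w(m)$. *)

(* Defs.v *)
From HB Require Import structures.
From mathcomp Require Import all_boot all_order all_algebra.
From mathcomp Require Import boolp functions.
From mathcomp.multinomials Require Import freeg.
Set Implicit Arguments.
Unset Strict Implicit.
Unset Printing Implicit Defensive.
Import GRing.Theory.
Local Open Scope quotient_scope.
Local Open Scope ring_scope.

(* Abelian groups presented by generators K and relations rel: the quotient of
   the free abelian group Z[K] by the subgroup generated by rel. *)
Section Pres.
Variables (K : choiceType) (rel : {freeg K / int} -> Prop).

Definition rel_span : {pred {freeg K / int}} := fun x =>
  `[< forall I : zmodClosed {freeg K / int},
        (forall z, rel z -> z \in (I : {pred _})) -> x \in (I : {pred _}) >].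

Lemma rel_span_closed : zmod_closed rel_span.
Proof.
split=> [|x y]; first by apply/asboolP => I _; rewrite rpred0.
move=> /asboolP hx /asboolP hy; apply/asboolP => I hI.
by rewrite rpredB ?hx ?hy.
Qed.

HB.instance Definition _ := GRing.isZmodClosed.Build {freeg K / int} rel_span
  rel_span_closed.

Lemma rel_span_sub z : rel z -> z \in rel_span.
Proof. by move=> hz; apply/asboolP => I; apply. Qed.

Definition pres : Type := {ideal_quot rel_span}.
HB.instance Definition _ := GRing.Zmodule.on pres.

Definition pres_pi (x : {freeg K / int}) : pres := \pi_{ideal_quot rel_span} x.

Lemma pres_pi_zmod : zmod_morphism pres_pi.
Proof. by move=> x y; rewrite /pres_pi !piE. Qed.

HB.instance Definition _ :=
  GRing.isZmodMorphism.Build {freeg K / int} pres pres_pi pres_pi_zmod.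

Lemma pres_pi_surj (x : pres) : exists y, x = pres_pi y.
Proof. by exists (repr x); rewrite /pres_pi reprK. Qed.

Definition pgen (k : K) : pres := pres_pi << k >>.

Lemma pres_eq x y : rel (x - y) -> pres_pi x = pres_pi y.
Proof.
by move=> hxy; apply/eqP; rewrite -Quotient.idealrBE; exact: rel_span_sub.
Qed.

Section Rec.
Variables (G : zmodType) (f : K -> G).

Definition zlift (x : {freeg K / int}) : G := fglift (f : K -> zmodule G) x.

Lemma zlift_zmod : zmod_morphism zlift.
Proof. exact: (@lift_is_additive int K (zmodule G) f). Qed.

HB.instance Definition _ :=
  GRing.isZmodMorphism.Build {freeg K / int} G zlift zlift_zmod.

Lemma zliftU k : zlift << k >> = f k.
Proof. by rewrite /zlift liftU scale1r. Qed.

Hypothesis f_rel : forall z, rel z -> zlift z = 0.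

Lemma zlift_span z : z \in rel_span -> zlift z = 0.
Proof.
pose I : {pred {freeg K / int}} := fun x => zlift x == 0.
have Icl : zmod_closed I.
  split=> [|x y]; first by rewrite /in_mem /= /I raddf0.
  rewrite /in_mem /= /I => /eqP hx /eqP hy.
  by rewrite raddfB /= hx hy subr0.
pose Im := GRing.isZmodClosed.Build {freeg K / int} I Icl.
pose J : zmodClosed {freeg K / int} := HB.pack I Im.
by move/asboolP/(_ J) => h; apply/eqP; apply: h => x /f_rel hx; rewrite /in_mem /= /I hx.
Qed.

Definition pres_rec (x : pres) : G := zlift (repr x).

Lemma pres_rec_pi x : pres_rec (pres_pi x) = zlift x.
Proof.
apply/eqP; rewrite /pres_rec -subr_eq0 -raddfB /=; apply/eqP/zlift_span.
by rewrite Quotient.idealrBE reprK.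
Qed.

Lemma pres_rec_zmod : zmod_morphism pres_rec.
Proof.
move=> x y; have [[u ->] [v ->]] := (pres_pi_surj x, pres_pi_surj y).
by rewrite -raddfB !pres_rec_pi raddfB.
Qed.

Definition pres_lift : {additive pres -> G} :=
  HB.pack pres_rec (GRing.isZmodMorphism.Build pres G pres_rec pres_rec_zmod).

Lemma pres_liftE k : pres_lift (pgen k) = f k.
Proof. by rewrite /= pres_rec_pi zliftU. Qed.
End Rec.

Lemma pres_ext (G : zmodType) (f g : {additive pres -> G}) :
  (forall k, f (pgen k) = g (pgen k)) -> f =1 g.
Proof.
move=> h x; have [y ->] := pres_pi_surj x; rewrite -[y]freeg_sumE !raddf_sum.
apply: eq_bigr => k _; rewrite -[coeff _ _]intz -freegU_mulz !raddfMz.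
by congr (_ *~ _); exact: h.
Qed.
End Pres.
Arguments pgen {K} rel k.
Arguments pres_lift {K rel G} f f_rel.

(* Right R-modules are modules over the converse ring: n r is (r : R^c) *: n.
   tens A B is the abelian group A (x)_R B. *)
Section Tensor.
Variables (R : pzRingType) (A : lmodType R^c) (B : lmodType R).

Inductive tens_rel : {freeg (A * B)%type / int} -> Prop :=
| TensDl a a' b :
    tens_rel (<< (a + a', b) >> - (<< (a, b) >> + << (a', b) >>))
| TensDr a b b' :
    tens_rel (<< (a, b + b') >> - (<< (a, b) >> + << (a, b') >>))
| TensZ a (r : R) b :
    tens_rel (<< ((r : R^c) *: a, b) >> - << (a, r *: b) >>).

Definition tens : Type := pres tens_rel.
HB.instance Definition _ := GRing.Zmodule.on tens.

Definition tpure (a : A) (b : B) : tens := pgen tens_rel (a, b).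

Definition balanced (G : zmodType) (h : A -> B -> G) :=
  [/\ forall a a' b, h (a + a') b = h a b + h a' b,
      forall a b b', h a (b + b') = h a b + h a b'
    & forall a (r : R) b, h ((r : R^c) *: a) b = h a (r *: b)].

Lemma balanced_rel (G : zmodType) (h : A -> B -> G) : balanced h ->
  forall z, tens_rel z -> zlift (fun p => h p.1 p.2) z = 0.
Proof.
move=> [hl hr hZ] _ [a a' b|a b b'|a r b]; rewrite raddfB ?raddfD /= !zliftU /=;
  by rewrite ?hl ?hr ?hZ -?opprD subrr.
Qed.

Definition tens_lift (G : zmodType) (h : A -> B -> G) (hh : balanced h) :
  {additive tens -> G} := pres_lift (fun p => h p.1 p.2) (balanced_rel hh).

Lemma tens_liftE (G : zmodType) (h : A -> B -> G) (hh : balanced h) a b :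
  tens_lift hh (tpure a b) = h a b.
Proof. exact: pres_liftE. Qed.

Lemma tens_ext (G : zmodType) (f g : {additive tens -> G}) :
  (forall a b, f (tpure a b) = g (tpure a b)) -> f =1 g.
Proof. by move=> h; apply: pres_ext => -[a b]; apply: h. Qed.

Lemma pure_balanced : balanced tpure.
Proof.
split=> [a a' b|a b b'|a r b].
- by rewrite /tpure /pgen -raddfD; apply: pres_eq; exact: TensDl.
- by rewrite /tpure /pgen -raddfD; apply: pres_eq; exact: TensDr.
- by apply: pres_eq; exact: TensZ.
Qed.
End Tensor.

Section TensorMap.
Variables (R : pzRingType) (A A' : lmodType R^c) (B B' : lmodType R).
Variables (f : {linear A -> A'}) (g : {linear B -> B'}).

Lemma tens_map_balanced : balanced (fun a b => tpure (f a) (g b)).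
Proof.
have [hl hr hZ] := @pure_balanced R A' B'.
by split=> [a a' b|a b b'|a r b]; rewrite ?raddfD ?linearZ /= ?hl ?hr ?hZ.
Qed.

Definition tens_map : {additive tens A B -> tens A' B'} :=
  tens_lift tens_map_balanced.

Lemma tens_mapE a b : tens_map (tpure a b) = tpure (f a) (g b).
Proof. exact: tens_liftE. Qed.
End TensorMap.

Lemma tens_map_idE (R : pzRingType) (A : lmodType R^c) (B : lmodType R)
    (f : {linear A -> A}) (g : {linear B -> B}) x :
  f =1 id -> g =1 id -> tens_map f g x = x.
Proof.
move=> hf hg; apply: (@tens_ext R A B _ (tens_map f g) idfun) => a b.
by rewrite tens_mapE hf hg.
Qed.

Lemma tens_map_compE (R : pzRingType) (A A' A'' : lmodType R^c)
    (B B' B'' : lmodType R) (f : {linear A -> A'}) (f' : {linear A' -> A''})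
    (f'' : {linear A -> A''}) (g : {linear B -> B'}) (g' : {linear B' -> B''})
    (g'' : {linear B -> B''}) x :
  (forall a, f' (f a) = f'' a) -> (forall b, g' (g b) = g'' b) ->
  tens_map f' g' (tens_map f g x) = tens_map f'' g'' x.
Proof.
move=> hf hg.
apply: (@tens_ext R A B _ (tens_map f' g' \o tens_map f g) (tens_map f'' g'')).
move=> a b; rewrite -[LHS]/(tens_map f' g' (tens_map f g (tpure a b))).
by rewrite !tens_mapE hf hg.
Qed.

Lemma tens_map_swapE (R : pzRingType) (A A1 A2 A' : lmodType R^c)
    (B B1 B2 B' : lmodType R)
    (f1 : {linear A -> A1}) (f1' : {linear A1 -> A'})
    (f2 : {linear A -> A2}) (f2' : {linear A2 -> A'})
    (g1 : {linear B -> B1}) (g1' : {linear B1 -> B'})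
    (g2 : {linear B -> B2}) (g2' : {linear B2 -> B'}) x :
  (forall a, f1' (f1 a) = f2' (f2 a)) -> (forall b, g1' (g1 b) = g2' (g2 b)) ->
  tens_map f1' g1' (tens_map f1 g1 x) = tens_map f2' g2' (tens_map f2 g2 x).
Proof.
move=> hf hg.
rewrite (@tens_map_compE _ _ _ _ _ _ _ _ _ (f2' \o f2) _ _ (g2' \o g2)) //.
by rewrite (@tens_map_compE _ _ _ _ _ _ _ _ _ (f2' \o f2) _ _ (g2' \o g2)).
Qed.

(* R<M> = (+)_n M^(x)n (x)_Z R, all degrees presented at once: generators are
   pairs (m_1 ... m_n, r), relations are additivity over Z in each m_i and in r
   with n fixed. word [:: m_1; ...; m_n] r stands for m_1 ... m_n . r. *)
Section TensAlg.
Variables (R : pzRingType) (M : lmodType R).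

Inductive tensalg_rel : {freeg (seq M * R)%type / int} -> Prop :=
| TalgDm u v m m' r :
    tensalg_rel (<< (u ++ (m + m') :: v, r) >> -
                 (<< (u ++ m :: v, r) >> + << (u ++ m' :: v, r) >>))
| TalgDr u r r' :
    tensalg_rel (<< (u, r + r') >> - (<< (u, r) >> + << (u, r') >>)).

Definition tensalg : Type := pres tensalg_rel.
HB.instance Definition _ := GRing.Zmodule.on tensalg.

Definition word (u : seq M) (r : R) : tensalg := pgen tensalg_rel (u, r).

Definition multiadd (G : zmodType) (h : seq M -> R -> G) :=
  (forall u v m m' r,
     h (u ++ (m + m') :: v) r = h (u ++ m :: v) r + h (u ++ m' :: v) r)
  /\ (forall u r r', h u (r + r') = h u r + h u r').

Lemma multiadd_rel (G : zmodType) (h : seq M -> R -> G) : multiadd h ->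
  forall z, tensalg_rel z -> zlift (fun p => h p.1 p.2) z = 0.
Proof.
by move=> [hm hr] _ [u v m m' r|u r r']; rewrite raddfB ?raddfD /= !zliftU /=
  ?hm ?hr -?opprD subrr.
Qed.

Definition tensalg_lift (G : zmodType) (h : seq M -> R -> G)
  (hh : multiadd h) : {additive tensalg -> G} :=
  pres_lift (fun p => h p.1 p.2) (multiadd_rel hh).

Lemma tensalg_liftE (G : zmodType) (h : seq M -> R -> G) (hh : multiadd h) u r :
  tensalg_lift hh (word u r) = h u r.
Proof. exact: pres_liftE. Qed.

Lemma tensalg_ext (G : zmodType) (f g : {additive tensalg -> G}) :
  (forall u r, f (word u r) = g (word u r)) -> f =1 g.
Proof. by move=> h; apply: pres_ext => -[u r]; apply: h. Qed.

Lemma word_multiadd : multiadd word.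
Proof.
split=> [u v m m' r|u r r'].
- by rewrite /word /pgen -raddfD; apply: pres_eq; exact: TalgDm.
- by rewrite /word /pgen -raddfD; apply: pres_eq; exact: TalgDr.
Qed.

Definition word_mul (u : seq M) (r : R) (v : seq M) (s : R) : tensalg :=
  if v is m :: v' then word (u ++ (r *: m) :: v') s else word u (r * s).

Lemma word_mulr_multiadd u r : multiadd (word_mul u r).
Proof.
have [hm hr] := word_multiadd; split=> [[|m0 v] w m m' s|[|m v] s s'] //=.
- by rewrite scalerDr hm.
- by rewrite -!cat_cons !catA hm.
- by rewrite mulrDr hr.
Qed.

Definition word_mulr u r : {additive tensalg -> tensalg} :=
  tensalg_lift (word_mulr_multiadd u r).

Lemma word_mulrE u r v s : word_mulr u r (word v s) = word_mul u r v s.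
Proof. exact: tensalg_liftE. Qed.

Lemma word_mull_multiadd :
  multiadd (fun u r => word_mulr u r : tensalg -> tensalg).
Proof.
have [hm hr] := word_multiadd.
split=> [u v m m' r|u r r']; apply/funext => x.
- apply: (@tensalg_ext tensalg (word_mulr _ _)
     (word_mulr _ _ \+ word_mulr _ _ )) => {x} w s.
  rewrite -[RHS]/(word_mulr _ _ _ + word_mulr _ _ _) !word_mulrE.
  case: w => [|m0 w];
  by rewrite /word_mul -?catA ?cat_cons hm.
- apply: (@tensalg_ext tensalg (word_mulr _ _)
     (word_mulr _ _ \+ word_mulr _ _ )) => {x} w s.
  rewrite -[RHS]/(word_mulr _ _ _ + word_mulr _ _ _) !word_mulrE.
  case: w => [|m0 w];
  by rewrite /word_mul ?mulrDl ?hr ?scalerDl ?hm.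
Qed.

Definition tensalg_mul (x y : tensalg) : tensalg :=
  tensalg_lift word_mull_multiadd x y.

Lemma tensalg_mulE u r v s :
  tensalg_mul (word u r) (word v s) = word_mul u r v s.
Proof. by rewrite /tensalg_mul tensalg_liftE word_mulrE. Qed.

Lemma tensalg_mull_zmod y : zmod_morphism (tensalg_mul^~ y).
Proof. by move=> x x'; rewrite /tensalg_mul raddfB. Qed.

Let mull y : {additive tensalg -> tensalg} :=
  HB.pack (tensalg_mul^~ y)
   (GRing.isZmodMorphism.Build tensalg tensalg _ (tensalg_mull_zmod y)).

Lemma tensalg_mulr_zmod x : zmod_morphism (tensalg_mul x).
Proof.
move=> y y'; apply: (@tensalg_ext tensalg (mull (y - y')) 
  (mull y \- mull y')) => u r /=.
by rewrite /tensalg_mul !tensalg_liftE raddfB.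
Qed.

Let mulr x : {additive tensalg -> tensalg} :=
  HB.pack (tensalg_mul x)
   (GRing.isZmodMorphism.Build tensalg tensalg _ (tensalg_mulr_zmod x)).

Lemma tensalg_mulA : associative tensalg_mul.
Proof.
move=> x y z.
apply: (@tensalg_ext tensalg (mull (tensalg_mul y z)) (mull z \o mull y)) => u r.
apply: (@tensalg_ext tensalg (mulr (word u r) \o mull z) 
  (mull z \o mulr (word u r))) => v s.
apply: (@tensalg_ext tensalg (mulr (word u r) \o mulr (word v s)) 
  (mulr (tensalg_mul (word u r) (word v s)))) => w t /=.
rewrite !tensalg_mulE; case: w v => [|m w] [|n v] /=;
  by rewrite !tensalg_mulE /= ?mulrA ?scalerA ?catA -?catA.
Qed.

Lemma tensalg_mul1 : left_id (word [::] 1) tensalg_mul.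
Proof.
move=> x; apply: (@tensalg_ext tensalg (mulr (word [::] 1)) idfun) => u r /=.
by rewrite tensalg_mulE; case: u => [|m u] /=; rewrite ?mul1r ?scale1r.
Qed.

Lemma tensalg_mul1r : right_id (word [::] 1) tensalg_mul.
Proof.
move=> x; apply: (@tensalg_ext tensalg (mull (word [::] 1)) idfun) => u r /=.
by rewrite tensalg_mulE /= mulr1.
Qed.

Lemma tensalg_mulDl : left_distributive tensalg_mul +%R.
Proof. by move=> x y z; exact: (raddfD (mull z)). Qed.

Lemma tensalg_mulDr : right_distributive tensalg_mul +%R.
Proof. by move=> x y z; exact: (raddfD (mulr x)). Qed.

HB.instance Definition _ := GRing.Zmodule_isPzRing.Build tensalg
  tensalg_mulA tensalg_mul1 tensalg_mul1r tensalg_mulDl tensalg_mulDr.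

Lemma wordM u r v s : word u r * word v s =
  if v is m :: v' then word (u ++ (r *: m) :: v') s else word u (r * s).
Proof. exact: tensalg_mulE. Qed.
End TensAlg.

(* The structure morphism is arbitrary: its image need not be central, so the
   library's algType does not apply. *)
Record ralg (R : pzRingType) := RAlg {
  ralg_ring :> pzRingType;
  ralg_map : {rmorphism R -> ralg_ring} }.

Record ralg_hom (R : pzRingType) (S T : ralg R) := RAlgHom {
  ralg_hom_fun :> {rmorphism S -> T};
  ralg_hom_map : forall r, ralg_hom_fun (ralg_map S r) = ralg_map T r }.

Lemma ralg_hom_eq (R : pzRingType) (S T : ralg R) (f g : ralg_hom S T) :
  f =1 g -> f = g.
Proof.
case: f g => [f hf] [g hg] /= fg.
have e : f = g.
  case: f fg {hf} => f cf; case: g {hg} => g cg /= fg.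
  have /funext e : f =1 g by exact: fg.
  by case: _ / e cg => cg; congr GRing.RMorphism.Pack; 
    case: cf cg => [[a] [b]] [[a'] [b']]; do 2!f_equal; f_equal; exact: Prop_irrelevance.
by case: _ / e hg => hg; congr RAlgHom; exact: Prop_irrelevance.
Qed.

Section RalgCategory.
Variable R : pzRingType.
Implicit Types S T U : ralg R.

Definition ralg_id S : ralg_hom S S :=
  @RAlgHom R S S idfun (fun=> erefl).

Lemma ralg_comp_map S T U (g : ralg_hom T U) (f : ralg_hom S T) r :
  (g \o f) (ralg_map S r) = ralg_map U r.
Proof. by rewrite /= !ralg_hom_map. Qed.

Definition ralg_comp S T U (g : ralg_hom T U) (f : ralg_hom S T) :
  ralg_hom S U := RAlgHom (ralg_comp_map g f).

(* An S-algebra seen as an R-algebra. *)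
Definition ralg_restr S (T : ralg S) : ralg R :=
  RAlg (ralg_map T \o ralg_map S).

Lemma ralg_hom_restr_map S (T T' : ralg S) (f : ralg_hom T T') r :
  f (ralg_map (ralg_restr T) r) = ralg_map (ralg_restr T') r.
Proof. exact: ralg_hom_map. Qed.

Definition ralg_hom_restr S (T T' : ralg S) (f : ralg_hom T T') :
  ralg_hom (ralg_restr T) (ralg_restr T') :=
  @RAlgHom R (ralg_restr T) (ralg_restr T') f (ralg_hom_restr_map f).

(* An S'-algebra seen as an S-algebra along phi : S -> S'. *)
Definition ralg_along S S' (phi : ralg_hom S S') (T : ralg S') : ralg S :=
  @RAlg S T (ralg_map T \o phi).

Definition ralg_hom_along S S' (phi : ralg_hom S S') (T T' : ralg S')
    (f : ralg_hom T T') : ralg_hom (ralg_along phi T) (ralg_along phi T') :=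
  @RAlgHom S (ralg_along phi T) (ralg_along phi T') f
    (fun s => ralg_hom_map f (phi s)).

(* The R-algebra structures of an S'-algebra T obtained through S' and through
   S are equal but not convertible; the identity of T identifies them. *)
Lemma ralg_along_map S S' (phi : ralg_hom S S') (T : ralg S') r :
  ralg_map (ralg_restr T) r = ralg_map (ralg_restr (ralg_along phi T)) r.
Proof. by rewrite /= ralg_hom_map. Qed.

Definition ralg_along_id S S' (phi : ralg_hom S S') (T : ralg S') :
  ralg_hom (ralg_restr T) (ralg_restr (ralg_along phi T)) :=
  @RAlgHom R (ralg_restr T) (ralg_restr (ralg_along phi T)) idfun
   (ralg_along_map phi T).
End RalgCategory.

(* S as a left, resp. right, R-module. *)
Definition ralg_l (R : pzRingType) (S : ralg R) : Type := S.
HB.instance Definition _ R S := GRing.Zmodule.on (@ralg_l R S).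

Definition ralg_r (R : pzRingType) (S : ralg R) : Type := S.
HB.instance Definition _ R S := GRing.Zmodule.on (@ralg_r R S).

Section RalgModules.
Variables (R : pzRingType) (S : ralg R).

Definition ralg_lscale (r : R) (s : ralg_l S) : ralg_l S :=
  ralg_map S r * (s : S).

Lemma ralg_lscaleA a b s :
  ralg_lscale a (ralg_lscale b s) = ralg_lscale (a * b) s.
Proof. by rewrite /ralg_lscale rmorphM mulrA. Qed.
Lemma ralg_lscale1 : left_id 1 ralg_lscale.
Proof. by move=> s; rewrite /ralg_lscale rmorph1 mul1r. Qed.
Lemma ralg_lscaleDr : right_distributive ralg_lscale +%R.
Proof. by move=> r s t; exact: mulrDr. Qed.
Lemma ralg_lscaleDl s : {morph ralg_lscale^~ s : a b / a + b}.
Proof. by move=> a b; rewrite /ralg_lscale rmorphD mulrDl. Qed.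

HB.instance Definition _ := GRing.Zmodule_isLmodule.Build R (ralg_l S)
  ralg_lscaleA ralg_lscale1 ralg_lscaleDr ralg_lscaleDl.

Definition ralg_rscale (r : R^c) (s : ralg_r S) : ralg_r S :=
  (s : S) * ralg_map S (r : R).

Lemma ralg_rscaleA a b s :
  ralg_rscale a (ralg_rscale b s) = ralg_rscale (a * b) s.
Proof. by rewrite /ralg_rscale -mulrA -rmorphM. Qed.
Lemma ralg_rscale1 : left_id 1 ralg_rscale.
Proof. by move=> s; rewrite /ralg_rscale rmorph1 mulr1. Qed.
Lemma ralg_rscaleDr : right_distributive ralg_rscale +%R.
Proof. by move=> r s t; exact: mulrDl. Qed.
Lemma ralg_rscaleDl s : {morph ralg_rscale^~ s : a b / a + b}.
Proof. by move=> a b; rewrite /ralg_rscale rmorphD mulrDr. Qed.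

HB.instance Definition _ := GRing.Zmodule_isLmodule.Build R^c (ralg_r S)
  ralg_rscaleA ralg_rscale1 ralg_rscaleDr ralg_rscaleDl.

Definition ralg_lmul (s : S) (s' : ralg_r S) : ralg_r S := s * (s' : S).
Lemma ralg_lmul_linear s : linear (ralg_lmul s).
Proof. by move=> r x y; rewrite /ralg_lmul [LHS]mulrDr mulrA. Qed.
HB.instance Definition _ s := GRing.isLinear.Build R^c (ralg_r S) (ralg_r S) _
  (ralg_lmul s) (ralg_lmul_linear s).

Definition ralg_rmul (s : S) (s' : ralg_l S) : ralg_l S := (s' : S) * s.
Lemma ralg_rmul_linear s : linear (ralg_rmul s).
Proof. by move=> r x y; rewrite /ralg_rmul [LHS]mulrDl -mulrA. Qed.
HB.instance Definition _ s := GRing.isLinear.Build R (ralg_l S) (ralg_l S) _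
  (ralg_rmul s) (ralg_rmul_linear s).
End RalgModules.

Section RalgHomLinear.
Variables (R : pzRingType) (S T : ralg R) (f : ralg_hom S T).
Definition ralg_hom_l (s : ralg_l S) : ralg_l T := f s.
Lemma ralg_hom_l_linear : linear ralg_hom_l.
Proof. by move=> r x y; rewrite /ralg_hom_l [LHS]rmorphD rmorphM ralg_hom_map. Qed.
HB.instance Definition _ := GRing.isLinear.Build R (ralg_l S) (ralg_l T) _
  ralg_hom_l ralg_hom_l_linear.
Definition ralg_hom_r (s : ralg_r S) : ralg_r T := f s.
Lemma ralg_hom_r_linear : linear ralg_hom_r.
Proof. by move=> r x y; rewrite /ralg_hom_r [LHS]rmorphD rmorphM ralg_hom_map. Qed.
HB.instance Definition _ := GRing.isLinear.Build R^c (ralg_r S) (ralg_r T) _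
  ralg_hom_r ralg_hom_r_linear.
End RalgHomLinear.

Section TensAlgRalg.
Variables (R : pzRingType) (M : lmodType R).

Definition tensalg_const (r : R) : tensalg M := word [::] r.
Lemma tensalg_const_nmod : nmod_morphism tensalg_const.
Proof.
have [_ hr] := @word_multiadd R M; split; last by move=> r s; exact: hr.
by apply: (addrI (tensalg_const 0)); rewrite -[LHS]hr !addr0.
Qed.
Lemma tensalg_const_monoid : monoid_morphism tensalg_const.
Proof. by split=> // r s; rewrite /tensalg_const wordM. Qed.
HB.instance Definition _ := GRing.isNmodMorphism.Build R (tensalg M)
  tensalg_const tensalg_const_nmod.
HB.instance Definition _ := GRing.isMonoidMorphism.Build R (tensalg M)
  tensalg_const tensalg_const_monoid.

Definition tensralg : ralg R := @RAlg R (tensalg M) tensalg_const.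

Definition tens_in (m : M) : ralg_l tensralg := word [:: m] 1.
Lemma tens_in_linear : linear tens_in.
Proof.
have [hm _] := @word_multiadd R M.
move=> r m m'; rewrite /tens_in (hm [::] [::]); congr (_ + _).
by rewrite /GRing.scale /= /ralg_lscale /= wordM.
Qed.
HB.instance Definition _ := GRing.isLinear.Build R M (ralg_l tensralg) _
  tens_in tens_in_linear.

Lemma wordE u r :
  word u r = (\prod_(m <- u) (tens_in m : tensralg)) * tensalg_const r.
Proof.
have h v : word v 1 = \prod_(m <- v) (tens_in m : tensralg).
  elim/last_ind: v => [|v m IH]; first by rewrite big_nil.
  by rewrite -cats1 big_cat big_seq1 -IH /= wordM scale1r.
by rewrite -h wordM mul1r.
Qed.

Section Lift.
Variables (S : ralg R) (w : {linear M -> ralg_l S}).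

Definition word_eval (u : seq M) (r : R) : S :=
  (\prod_(m <- u) (w m : S)) * ralg_map S r.

Lemma word_eval_multiadd : multiadd word_eval.
Proof.
split=> [u v m m' r|u r r']; rewrite /word_eval.
  by rewrite !big_cat !big_cons raddfD /= [in LHS]mulrDl mulrDr mulrDl.
by rewrite rmorphD mulrDr.
Qed.

Definition tens_eval : tensalg M -> S := tensalg_lift word_eval_multiadd.

Lemma tens_evalE u r : tens_eval (word u r) = word_eval u r.
Proof. exact: tensalg_liftE. Qed.

HB.instance Definition _ := GRing.Additive.on tens_eval.

Lemma tens_eval_monoid : monoid_morphism tens_eval.
Proof.
split; first by rewrite [LHS]tens_evalE /word_eval big_nil mul1r rmorph1.
move=> x y.
have h u r : tens_eval (word u r * y) = tens_eval (word u r) * tens_eval y.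
  apply: (@tensalg_ext R M S (tens_eval \o (word u r \*o idfun))
    (tens_eval (word u r) \*o tens_eval)) => v s /=.
  rewrite wordM !tens_evalE /word_eval.
  case: v => [|m v]; first by rewrite tens_evalE /word_eval big_nil mul1r rmorphM mulrA.
  rewrite tens_evalE /word_eval big_cat !big_cons linearZ /=.
  by rewrite [X in _ * (X * _) * _]/GRing.scale /= /ralg_lscale !mulrA.
exact: (@tensalg_ext R M S (tens_eval \o (y \o* idfun))
   (tens_eval y \o* tens_eval)).
Qed.

HB.instance Definition _ := GRing.isMonoidMorphism.Build (tensalg M) S
  tens_eval tens_eval_monoid.

Lemma tens_eval_map r : tens_eval (ralg_map tensralg r) = ralg_map S r.
Proof. by rewrite [LHS]tens_evalE /word_eval big_nil mul1r. Qed.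

Definition tens_ext_hom : ralg_hom tensralg S := 
  @RAlgHom R tensralg S tens_eval tens_eval_map.

Lemma tens_ext_homE m : tens_ext_hom (tens_in m) = w m.
Proof. by rewrite [LHS]tens_evalE /word_eval big_seq1 rmorph1 mulr1. Qed.
End Lift.

Lemma tens_hom_eq (S : ralg R) (f g : ralg_hom tensralg S) :
  (forall m, f (tens_in m) = g (tens_in m)) -> f = g.
Proof.
move=> h; apply: ralg_hom_eq.
apply: (@tensalg_ext R M S f g) => u r /=; rewrite wordE !rmorphM !rmorph_prod.
congr (_ * _); first by apply: eq_bigr => m _; exact: h.
by rewrite -[tensalg_const r]/(ralg_map tensralg r) !ralg_hom_map.
Qed.
End TensAlgRalg.

(* The values of a functor on R-algebras cannot be taken in zmodType: M^*(S)
   consists of families indexed by all S-algebras, hence lives in a universe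
   strictly above the one of zmodType. *)
Record abGroup := AbGroup {
  ab_sort :> Type;
  ab_zero : ab_sort;
  ab_opp : ab_sort -> ab_sort;
  ab_add : ab_sort -> ab_sort -> ab_sort;
  ab_addA : associative ab_add;
  ab_addC : commutative ab_add;
  ab_add0 : left_id ab_zero ab_add;
  ab_addN : left_inverse ab_zero ab_opp ab_add }.
Arguments ab_zero {a}.

Definition ab_of_zmod (V : zmodType) : abGroup :=
  @AbGroup V 0 -%R +%R (@addrA V) (@addrC V) (@add0r V) (@addNr V).

Section AbGroupTheory.
Variable A : abGroup.
Implicit Types x y z : A.

Lemma ab_add0r x : ab_add x ab_zero = x.
Proof. by rewrite ab_addC ab_add0. Qed.
Lemma ab_addI x : injective (ab_add x).
Proof.
by move=> y z e; rewrite -[y]ab_add0 -[z]ab_add0 -(ab_addN x) -!ab_addA e.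
Qed.
Lemma ab_addACA : interchange (@ab_add A) (@ab_add A).
Proof. by move=> x y z t; rewrite -!ab_addA (ab_addA y) (ab_addC y) !ab_addA. Qed.
Lemma ab_oppD x y : ab_opp (ab_add x y) = ab_add (ab_opp x) (ab_opp y).
Proof.
apply: (@ab_addI (ab_add x y)); rewrite ab_addC ab_addN ab_addACA.
by rewrite !(ab_addC _ (ab_opp _)) !ab_addN ab_add0.
Qed.
End AbGroupTheory.

Record ab_hom (A B : abGroup) := AbHom {
  ab_fun :> A -> B;
  ab_funD : forall x y, ab_fun (ab_add x y) = ab_add (ab_fun x) (ab_fun y) }.

Section AbHomTheory.
Variables (A B : abGroup) (f : A -> B).
Hypothesis fD : forall x y, f (ab_add x y) = ab_add (f x) (f y).
Lemma abD0 : f ab_zero = ab_zero.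
Proof. by apply: (@ab_addI B (f ab_zero)); rewrite -fD ab_add0 ab_add0r. Qed.
Lemma abDN x : f (ab_opp x) = ab_opp (f x).
Proof.
by apply: (@ab_addI B (f x)); rewrite -fD ![ab_add _ (ab_opp _)]ab_addC !ab_addN abD0.
Qed.
End AbHomTheory.

Lemma ab_fun0 (A B : abGroup) (f : ab_hom A B) : f ab_zero = ab_zero.
Proof. exact/abD0/ab_funD. Qed.
Lemma ab_funN (A B : abGroup) (f : ab_hom A B) x : f (ab_opp x) = ab_opp (f x).
Proof. exact/abDN/ab_funD. Qed.

Definition ab_of_additive (V W : zmodType) (f : {additive V -> W}) :
  ab_hom (ab_of_zmod V) (ab_of_zmod W) :=
  @AbHom (ab_of_zmod V) (ab_of_zmod W) f (raddfD f).

(* Functors from R-algebras to abelian groups. *)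
Record abfun (R : pzRingType) := AbFun {
  af_obj :> ralg R -> abGroup;
  af_map : forall S T, ralg_hom S T -> ab_hom (af_obj S) (af_obj T);
  af_map_id : forall S x, af_map (ralg_id S) x = x;
  af_map_comp : forall S T U (g : ralg_hom T U) (f : ralg_hom S T) x,
    af_map (ralg_comp g f) x = af_map g (af_map f x) }.

Lemma af_map_eq (R : pzRingType) (F : abfun R) (S T : ralg R)
  (f g : ralg_hom S T) x : f =1 g -> af_map F f x = af_map F g x.
Proof. by move/ralg_hom_eq->. Qed.

Record lmodfun (R : pzRingType) := LModFun {
  lf_fun :> abfun R;
  lf_act : forall S : ralg R, S -> lf_fun S -> lf_fun S;
  lf_actA : forall (S : ralg R) (s t : S) x,
    lf_act s (lf_act t x) = lf_act (s * t) x;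
  lf_act1 : forall (S : ralg R) x, lf_act (1 : S) x = x;
  lf_actDr : forall (S : ralg R) (s : S) x y,
    lf_act s (ab_add x y) = ab_add (lf_act s x) (lf_act s y);
  lf_actDl : forall (S : ralg R) (s t : S) x,
    lf_act (s + t) x = ab_add (lf_act s x) (lf_act t x);
  lf_act_map : forall (S T : ralg R) (f : ralg_hom S T) s x,
    af_map lf_fun f (lf_act s x) = lf_act (f s) (af_map lf_fun f x) }.

Record rmodfun (R : pzRingType) := RModFun {
  rf_fun :> abfun R;
  rf_act : forall S : ralg R, rf_fun S -> S -> rf_fun S;
  rf_actA : forall (S : ralg R) x (s t : S),
    rf_act (rf_act x s) t = rf_act x (s * t);
  rf_act1 : forall (S : ralg R) x, rf_act x (1 : S) = x;
  rf_actDl : forall (S : ralg R) x y (s : S),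
    rf_act (ab_add x y) s = ab_add (rf_act x s) (rf_act y s);
  rf_actDr : forall (S : ralg R) x (s t : S),
    rf_act x (s + t) = ab_add (rf_act x s) (rf_act x t);
  rf_act_map : forall (S T : ralg R) (f : ralg_hom S T) x s,
    af_map rf_fun f (rf_act x s) = rf_act (af_map rf_fun f x) (f s) }.

Record lmodhom (R : pzRingType) (F G : lmodfun R) := LModHom {
  lh_fun :> forall S, F S -> G S;
  lh_add : forall (S : ralg R) (x y : F S),
    lh_fun (ab_add x y) = ab_add (lh_fun x) (lh_fun y);
  lh_act : forall (S : ralg R) (s : S) (x : F S),
    lh_fun (lf_act s x) = lf_act s (lh_fun x);
  lh_nat : forall (S T : ralg R) (f : ralg_hom S T) x,
    lh_fun (af_map F f x) = af_map G f (lh_fun x) }.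

Record rmodhom (R : pzRingType) (F G : rmodfun R) := RModHom {
  rh_fun :> forall S, F S -> G S;
  rh_add : forall (S : ralg R) (x y : F S),
    rh_fun (ab_add x y) = ab_add (rh_fun x) (rh_fun y);
  rh_act : forall (S : ralg R) (x : F S) (s : S),
    rh_fun (rf_act x s) = rf_act (rh_fun x) s;
  rh_nat : forall (S T : ralg R) (f : ralg_hom S T) x,
    rh_fun (af_map F f x) = af_map G f (rh_fun x) }.

Lemma lmodhom_eq (R : pzRingType) (F G : lmodfun R) (f g : lmodhom F G) :
  (forall S x, f S x = g S x) -> f = g.
Proof.
case: f g => [f ? ? ?] [g ? ? ?] /= e.
have {}e : f = g by apply: functional_extensionality_dep => S; exact/funext.
by subst g; congr LModHom; exact: Prop_irrelevance.
Qed.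

Lemma rmodhom_eq (R : pzRingType) (F G : rmodfun R) (f g : rmodhom F G) :
  (forall S x, f S x = g S x) -> f = g.
Proof.
case: f g => [f ? ? ?] [g ? ? ?] /= e.
have {}e : f = g by apply: functional_extensionality_dep => S; exact/funext.
by subst g; congr RModHom; exact: Prop_irrelevance.
Qed.

Section LModHomGroup.
Variables (R : pzRingType) (F G : lmodfun R).
Implicit Types f g : lmodhom F G.

Lemma lf_act0 (H : lmodfun R) (S : ralg R) (s : S) : lf_act s (ab_zero : H S) = ab_zero.
Proof. exact/abD0/lf_actDr. Qed.
Lemma lf_actN (H : lmodfun R) (S : ralg R) (s : S) (x : H S) :
  lf_act s (ab_opp x) = ab_opp (lf_act s x).
Proof. exact/abDN/lf_actDr. Qed.

Definition lh_zero : lmodhom F G.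
Proof.
exists (fun S _ => ab_zero) => [S x y|S s x|S T f x].
- by rewrite ab_add0.
- by rewrite lf_act0.
- by rewrite ab_fun0.
Defined.

Definition lh_opp f : lmodhom F G.
Proof.
exists (fun S x => ab_opp (f S x)) => [S x y|S s x|S T h x].
- by rewrite lh_add ab_oppD.
- by rewrite lh_act lf_actN.
- by rewrite lh_nat ab_funN.
Defined.

Definition lh_sum f g : lmodhom F G.
Proof.
exists (fun S x => ab_add (f S x) (g S x)) => [S x y|S s x|S T h x].
- by rewrite !lh_add ab_addACA.
- by rewrite !lh_act lf_actDr.
- by rewrite !lh_nat ab_funD.
Defined.

Definition lmodhom_ab : abGroup.
Proof.
apply: (@AbGroup (lmodhom F G) lh_zero lh_opp lh_sum) =>
 [f g h|f g|f|f]; apply: lmodhom_eq => S x /=.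
- exact: ab_addA.
- exact: ab_addC.
- exact: ab_add0.
- exact: ab_addN.
Defined.
End LModHomGroup.

Section RModHomGroup.
Variables (R : pzRingType) (F G : rmodfun R).
Implicit Types f g : rmodhom F G.

Lemma rf_act0 (H : rmodfun R) (S : ralg R) (s : S) : rf_act (ab_zero : H S) s = ab_zero.
Proof. by apply: (abD0 (f := fun x : H S => rf_act x s)) => x y; exact: rf_actDl. Qed.
Lemma rf_actN (H : rmodfun R) (S : ralg R) (s : S) (x : H S) :
  rf_act (ab_opp x) s = ab_opp (rf_act x s).
Proof. by apply: (abDN (f := fun x : H S => rf_act x s)) => {}x y; exact: rf_actDl. Qed.

Definition rh_zero : rmodhom F G.
Proof.
exists (fun S _ => ab_zero) => [S x y|S s x|S T f x].
- by rewrite ab_add0.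
- by rewrite rf_act0.
- by rewrite ab_fun0.
Defined.

Definition rh_opp f : rmodhom F G.
Proof.
exists (fun S x => ab_opp (f S x)) => [S x y|S s x|S T h x].
- by rewrite rh_add ab_oppD.
- by rewrite rh_act rf_actN.
- by rewrite rh_nat ab_funN.
Defined.

Definition rh_sum f g : rmodhom F G.
Proof.
exists (fun S x => ab_add (f S x) (g S x)) => [S x y|S s x|S T h x].
- by rewrite !rh_add ab_addACA.
- by rewrite !rh_act rf_actDl.
- by rewrite !rh_nat ab_funD.
Defined.

Definition rmodhom_ab : abGroup.
Proof.
apply: (@AbGroup (rmodhom F G) rh_zero rh_opp rh_sum) =>
 [f g h|f g|f|f]; apply: rmodhom_eq => S x /=.
- exact: ab_addA.
- exact: ab_addC.
- exact: ab_add0.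
- exact: ab_addN.
Defined.

Definition rmodhom_comp (H : rmodfun R) (g : rmodhom G H) (f : rmodhom F G) :
  rmodhom F H.
Proof.
exists (fun S x => g S (f S x)) => [S x y|S x s|S T h x].
- by rewrite !rh_add.
- by rewrite !rh_act.
- by rewrite !rh_nat.
Defined.
End RModHomGroup.

Section Dual.
Variable R : pzRingType.

Definition abfun_restr (F : abfun R) (S : ralg R) : abfun S.
Proof.
apply: (@AbFun S (fun T => F (ralg_restr T))
   (fun T T' f => af_map F (ralg_hom_restr f))) => [T x|T T' T'' g f x].
- by rewrite -[RHS]af_map_id; exact: af_map_eq.
- by rewrite -af_map_comp; exact: af_map_eq.
Defined.

Definition lmodfun_restr (F : lmodfun R) (S : ralg R) : lmodfun S.
Proof.
apply: (@LModFun S (abfun_restr F S) (fun T t x => lf_act (S := ralg_restr T) t x)).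
- by move=> T s t x; exact: (@lf_actA R F (ralg_restr T)).
- by move=> T x; exact: (@lf_act1 R F (ralg_restr T)).
- by move=> T s x y; exact: (@lf_actDr R F (ralg_restr T)).
- by move=> T s t x; exact: (@lf_actDl R F (ralg_restr T)).
- by move=> T T' f s x; exact: (lf_act_map (ralg_hom_restr f)).
Defined.

Definition lmodfun_reg (S : pzRingType) : lmodfun S.
Proof.
pose A := @AbFun S (fun T => ab_of_zmod T) (fun T T' f => ab_of_additive f)
  (fun T x => erefl) (fun T T' T'' g f x => erefl).
apply: (@LModFun S A (fun T (t : T) (x : T) => t * x)).
- by move=> T s t x; exact: mulrA.
- by move=> T x; exact: mul1r.
- by move=> T s x y; exact: mulrDr.
- by move=> T s t x; exact: mulrDl.
- by move=> T T' f s x; exact: (rmorphM f).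
Defined.

Variable F : lmodfun R.

(* F^*(S) is the group of morphisms F_|S -> S of left modules on S-algebras. *)
Definition dual_hom (S : ralg R) : Type :=
  lmodhom (lmodfun_restr F S) (lmodfun_reg S).

Definition dual_obj (S : ralg R) : abGroup :=
  lmodhom_ab (lmodfun_restr F S) (lmodfun_reg S).

Definition dual_act (S : ralg R) (f : dual_hom S) (s : S) : dual_hom S.
Proof.
exists (fun (T : ralg S) x => (f T x : T) * ralg_map T s)
  => [T x y|T t x|T T' h x].
- by rewrite lh_add; exact: mulrDl.
- by rewrite lh_act /= mulrA.
- by rewrite lh_nat /= rmorphM ralg_hom_map.
Defined.

Definition dual_map_fun (S S' : ralg R) (phi : ralg_hom S S') (f : dual_hom S) :
  dual_hom S'.
Proof.
exists (fun (T : ralg S') (x : F (ralg_restr T)) =>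
     f (ralg_along phi T) (af_map F (ralg_along_id phi T) x) : T).
- by move=> T x y; rewrite ab_funD; exact: (@lh_add _ _ _ f (ralg_along phi T)).
- move=> T t x; rewrite [X in f _ X](lf_act_map (ralg_along_id phi T)).
  exact: (@lh_act _ _ _ f (ralg_along phi T)).
- move=> T T' h x.
  rewrite -[RHS](lh_nat f (ralg_hom_along phi h)) /= -!af_map_comp.
  by f_equal; exact: af_map_eq.
Defined.

Lemma dual_map_funD (S S' : ralg R) (phi : ralg_hom S S') (f g : dual_obj S) :
  dual_map_fun phi (ab_add f g) =
  ab_add (dual_map_fun phi f : dual_obj S') (dual_map_fun phi g).
Proof. exact: lmodhom_eq. Qed.

Definition dual_map (S S' : ralg R) (phi : ralg_hom S S') :
  ab_hom (dual_obj S) (dual_obj S') :=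
  @AbHom (dual_obj S) (dual_obj S') (dual_map_fun phi) (dual_map_funD phi).

Lemma dual_map_id (S : ralg R) (f : dual_obj S) : dual_map (ralg_id S) f = f.
Proof.
apply: lmodhom_eq => T x /=.
pose k : ralg_hom T (ralg_along (ralg_id S) T) :=
  @RAlgHom S T (ralg_along (ralg_id S) T) idfun (fun=> erefl).
rewrite -[RHS](lh_nat f k) /=.
by f_equal; exact: af_map_eq.
Qed.

Lemma dual_map_comp (S S' S'' : ralg R) (g : ralg_hom S' S'') (h : ralg_hom S S')
  (f : dual_obj S) : dual_map (ralg_comp g h) f = dual_map g (dual_map h f).
Proof.
apply: lmodhom_eq => T x /=.
pose k : ralg_hom (ralg_along h (ralg_along g T)) (ralg_along (ralg_comp g h) T) :=
  @RAlgHom S (ralg_along h (ralg_along g T)) (ralg_along (ralg_comp g h) T)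
    idfun (fun=> erefl).
rewrite -[RHS](lh_nat f k) /= -!af_map_comp.
by f_equal; exact: af_map_eq.
Qed.

Definition dual_abfun : abfun R := AbFun dual_map_id dual_map_comp.

Definition dualfun : rmodfun R.
Proof.
apply: (@RModFun R dual_abfun dual_act).
- by move=> S f s t; apply: lmodhom_eq => T x /=; rewrite rmorphM mulrA.
- by move=> S f; apply: lmodhom_eq => T x /=; rewrite rmorph1 mulr1.
- by move=> S f g s; apply: lmodhom_eq => T x; exact: mulrDl.
- by move=> S f s t; apply: lmodhom_eq => T x /=; rewrite rmorphD; exact: mulrDr.
- by move=> S S' phi f s; exact: lmodhom_eq.
Defined.
End Dual.

Definition dual_mor (R : pzRingType) (F G : lmodfun R) (w : lmodhom F G) :
  rmodhom (dualfun G) (dualfun F).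
Proof.
unshelve refine (@RModHom R (dualfun G) (dualfun F) _ _ _ _).
- move=> S f; exists (fun (T : ralg S) (x : F (ralg_restr T)) => 
    (f : dual_hom G S) T (w (ralg_restr T) x) : T).
  + by move=> T x y; rewrite lh_add (lh_add f).
  + by move=> T t x; rewrite [X in _ T X]lh_act (lh_act f).
  + by move=> T T' h x; rewrite [X in _ T' X]lh_nat (lh_nat f).
- by move=> S f g; exact: lmodhom_eq.
- by move=> S f s; exact: lmodhom_eq.
- by move=> S S' phi f; apply: lmodhom_eq => T x /=; rewrite lh_nat.
Defined.

(* qcoh_l M is S |-> S (x)_R M, qcoh_r N is S |-> N (x)_R S. *)
Section QuasiCoherent.
Variable R : pzRingType.

Definition qcoh_l_abfun (M : lmodType R) : abfun R.
Proof.
apply: (@AbFun R (fun S => ab_of_zmod (tens (ralg_r S) M))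
  (fun S T f => ab_of_additive (tens_map (ralg_hom_r f) idfun)))
  => [S x|S T U g f x].
- exact: tens_map_idE.
- by apply/esym/tens_map_compE.
Defined.

Definition qcoh_l (M : lmodType R) : lmodfun R.
Proof.
apply: (@LModFun R (qcoh_l_abfun M)
  (fun S s => tens_map (ralg_lmul s) (idfun : {linear M -> M}))).
- by move=> S s t x; apply: tens_map_compE => // a; exact: mulrA.
- by move=> S x; apply: tens_map_idE => // a; exact: mul1r.
- by move=> S s x y; exact: raddfD.
- move=> S s t x.
  apply: (@tens_ext R _ _ _ (tens_map _ _) (tens_map _ _ \+ tens_map _ _)) => a b.
  rewrite -[RHS]/(tens_map _ _ _ + tens_map _ _ _) !tens_mapE.
  have [hl _ _] := @pure_balanced R (ralg_r S) M.
  by rewrite -hl; congr tpure; exact: mulrDl.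
- by move=> S T f s x; apply: tens_map_swapE => // a; exact: (rmorphM f).
Defined.

Definition qcoh_r_abfun (N : lmodType R^c) : abfun R.
Proof.
apply: (@AbFun R (fun S => ab_of_zmod (tens N (ralg_l S)))
  (fun S T f => ab_of_additive (tens_map idfun (ralg_hom_l f))))
  => [S x|S T U g f x].
- exact: tens_map_idE.
- by apply/esym/tens_map_compE.
Defined.

Definition qcoh_r (N : lmodType R^c) : rmodfun R.
Proof.
apply: (@RModFun R (qcoh_r_abfun N)
  (fun S x s => tens_map (idfun : {linear N -> N}) (ralg_rmul s) x)).
- by move=> S x s t; apply: tens_map_compE => // a; apply/esym/mulrA.
- by move=> S x; apply: tens_map_idE => // a; exact: mulr1.
- by move=> S x y s; exact: raddfD.
- move=> S x s t.
  apply: (@tens_ext R _ _ _ (tens_map _ _) (tens_map _ _ \+ tens_map _ _)) => a b.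
  rewrite -[RHS]/(tens_map _ _ _ + tens_map _ _ _) !tens_mapE.
  have [_ hr _] := @pure_balanced R N (ralg_l S).
  by rewrite -hr; congr tpure; exact: mulrDr.
- by move=> S T f x s; apply: tens_map_swapE => // a; exact: (rmorphM f).
Defined.

Definition qcoh_l_mor (M M' : lmodType R) (w : {linear M -> M'}) :
  lmodhom (qcoh_l M) (qcoh_l M').
Proof.
apply: (@LModHom R (qcoh_l M) (qcoh_l M')
  (fun S => tens_map (idfun : {linear ralg_r S -> ralg_r S}) w)).
- by move=> S x y; exact: raddfD.
- by move=> S s x; exact: tens_map_swapE.
- by move=> S T f x; exact: tens_map_swapE.
Defined.

Definition qcoh_r_mor (N N' : lmodType R^c) (v : {linear N -> N'}) :
  rmodhom (qcoh_r N) (qcoh_r N').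
Proof.
apply: (@RModHom R (qcoh_r N) (qcoh_r N')
  (fun S => tens_map v (idfun : {linear ralg_l S -> ralg_l S}))).
- by move=> S x y; exact: raddfD.
- by move=> S x s; exact: tens_map_swapE.
- by move=> S T f x; exact: tens_map_swapE.
Defined.
End QuasiCoherent.

Section Extension.
Variable R : pzRingType.
Local Notation withx M := (M * R^o)%type.

(* tens_gen M is x = (0, 1), and tens_hx M is the R-algebra endomorphism h_x of
   R<M (+) Rx> (see tens_hx_in and tens_hx_gen). *)
Definition tens_gen (M : lmodType R) : tensralg (withx M) :=
  tens_in ((0, 1) : withx M).

Definition tens_hx_lin (M : lmodType R) (p : withx M) :
    ralg_l (tensralg (withx M)) :=
  (tens_in ((p.1, 0) : withx M) : tensralg _) * tens_gen M
  + tens_in ((0, p.2) : withx M).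

Lemma tens_hx_linear (M : lmodType R) : linear (@tens_hx_lin M).
Proof.
move=> r [m s] [m' s']; rewrite /tens_hx_lin /=.
have -> : (r *: m + m', 0) = r *: (m, 0) + (m', 0) :> (withx M).
  by congr pair; rewrite /= scaler0 addr0.
have -> : (0, r *: s + s') = r *: (0, s) + (0, s') :> (withx M).
  by congr pair; rewrite /= scaler0 addr0.
rewrite !linearP scalerDr [RHS]addrACA; congr (_ + _).
by rewrite [LHS]mulrDl; congr (_ + _); exact/esym/mulrA.
Qed.
HB.instance Definition _ (M : lmodType R) := GRing.isLinear.Build R (withx M)
  (ralg_l (tensralg (withx M))) _ (@tens_hx_lin M) (@tens_hx_linear M).

Definition tens_hx (M : lmodType R) :
  ralg_hom (tensralg (withx M)) (tensralg (withx M)) :=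
  tens_ext_hom (@tens_hx_lin M).

Lemma tens_hx_in (M : lmodType R) (m : M) :
  tens_hx M (tens_in ((m, 0) : withx M)) =
  (tens_in ((m, 0) : withx M) : tensralg _) * tens_gen M.
Proof.
rewrite /tens_hx tens_ext_homE /= /tens_hx_lin /=.
by rewrite (linear0 (@tens_in R (withx M))) addr0.
Qed.

Lemma tens_hx_gen (M : lmodType R) : tens_hx M (tens_gen M) = tens_gen M.
Proof.
rewrite /tens_hx tens_ext_homE /= /tens_hx_lin /=.
by rewrite (linear0 (@tens_in R (withx M))) mul0r add0r.
Qed.

Definition tens_fmap (M M' : lmodType R) (w : {linear M -> M'}) :
  ralg_hom (tensralg M) (tensralg M') := tens_ext_hom (@tens_in R M' \o w).

Lemma tens_fmap_in (M M' : lmodType R) (w : {linear M -> M'}) m :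
  tens_fmap w (tens_in m) = tens_in (w m).
Proof. exact: tens_ext_homE. Qed.

Definition inj_l (M : lmodType R) (m : M) : withx M := (m, 0).
Lemma inj_l_linear (M : lmodType R) : linear (@inj_l M).
Proof. by move=> r m m'; congr pair; rewrite /= scaler0 addr0. Qed.
HB.instance Definition _ (M : lmodType R) := GRing.isLinear.Build R M (withx M) _
  (@inj_l M) (@inj_l_linear M).

Definition with_map (M M' : lmodType R) (w : {linear M -> M'}) (p : withx M) :
  withx M' := (w p.1, p.2).
Lemma with_map_linear (M M' : lmodType R) (w : {linear M -> M'}) :
  linear (with_map w).
Proof. by move=> r p p'; congr pair; exact: linearP. Qed.
HB.instance Definition _ (M M' : lmodType R) (w : {linear M -> M'}) :=
  GRing.isLinear.Build R (withx M) (withx M') _ (with_map w) (with_map_linear w).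

Variable F : rmodfun R.

Definition ext_pred (M : lmodType R) (f : F (tensralg M)) : Prop :=
  let f' := af_map F (tens_fmap (@inj_l M)) f in
  af_map F (tens_hx M) f' = rf_act f' (tens_gen M).

Definition ext_sort (M : lmodType R) : Type :=
  {f : F (tensralg M) | ext_pred f}.

Lemma ext_eq (M : lmodType R) (f g : ext_sort M) : sval f = sval g -> f = g.
Proof.
by case: f g => [f hf] [g hg] /= e; subst g; congr exist; exact: Prop_irrelevance.
Qed.

Lemma ext_zero_subproof (M : lmodType R) : ext_pred (ab_zero : F (tensralg M)).
Proof. by rewrite /ext_pred !ab_fun0 rf_act0. Qed.
Lemma ext_opp_subproof (M : lmodType R) (f : ext_sort M) : ext_pred (ab_opp (sval f)).
Proof. by rewrite /ext_pred !ab_funN rf_actN; congr ab_opp; exact: (svalP f). Qed.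
Lemma ext_add_subproof (M : lmodType R) (f g : ext_sort M) :
  ext_pred (ab_add (sval f) (sval g)).
Proof.
rewrite /ext_pred !ab_funD rf_actDl.
by congr ab_add; [exact: (svalP f)|exact: (svalP g)].
Qed.

Definition extension (M : lmodType R) : abGroup.
Proof.
apply: (@AbGroup (ext_sort M)
  (exist _ _ (ext_zero_subproof M))
  (fun f => exist _ _ (ext_opp_subproof f))
  (fun f g => exist _ _ (ext_add_subproof f g)))
  => [f g h|f g|f|f]; apply: ext_eq => /=.
- exact: ab_addA.
- exact: ab_addC.
- exact: ab_add0.
- exact: ab_addN.
Defined.

Lemma ext_map_subproof (M M' : lmodType R) (w : {linear M -> M'})
    (f : extension M) : ext_pred (af_map F (tens_fmap w) (sval f)).
Proof.
pose W := tens_fmap (@with_map M M' w).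
have WE p : W (tens_in p) = tens_in (with_map w p) by exact: tens_fmap_in.
have Wl x : W (tens_fmap (@inj_l M) x) = tens_fmap (@inj_l M') (tens_fmap w x).
  rewrite -[LHS]/(ralg_comp W (tens_fmap (@inj_l M)) x).
  rewrite -[RHS]/(ralg_comp (tens_fmap (@inj_l M')) (tens_fmap w) x).
  congr (ralg_hom_fun _ x); apply: tens_hom_eq => m.
  rewrite -[LHS]/(W (tens_fmap (@inj_l M) (tens_in m))).
  rewrite -[RHS]/(tens_fmap (@inj_l M') (tens_fmap w (tens_in m))).
  rewrite !tens_fmap_in; congr tens_in.
have Wx : W (tens_gen M) = tens_gen M'.
  by rewrite [LHS]WE; congr tens_in; congr pair; rewrite /= linear0.
have Wh x : W (tens_hx M x) = tens_hx M' (W x).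
  rewrite -[LHS]/(ralg_comp W (tens_hx M) x) -[RHS]/(ralg_comp (tens_hx M') W x).
  congr (ralg_hom_fun _ x); apply: tens_hom_eq => p.
  rewrite -[LHS]/(W (tens_hx M (tens_in p))).
  rewrite -[RHS]/(tens_hx M' (W (tens_in p))) WE.
  rewrite !tens_ext_homE /= /tens_hx_lin rmorphD rmorphM /= Wx !WE.
  by congr (_ * _ + _); congr tens_in; congr pair; rewrite /= linear0.
have fl : af_map F (tens_fmap (@inj_l M')) (af_map F (tens_fmap w) (sval f))
     = af_map F W (af_map F (tens_fmap (@inj_l M)) (sval f)).
  by rewrite -!af_map_comp; apply: af_map_eq => x; exact/esym/Wl.
rewrite /ext_pred fl -Wx -rf_act_map -(svalP f) -!af_map_comp.
by apply: af_map_eq => x; exact/esym/Wh.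
Qed.

Definition extension_map (M M' : lmodType R) (w : {linear M -> M'}) :
  ab_hom (extension M) (extension M').
Proof.
exists (fun f => exist _ _ (ext_map_subproof w f)) => f g.
by apply: ext_eq; exact: ab_funD.
Defined.

Lemma extension_map_id (M : lmodType R) (f : extension M) :
  extension_map idfun f = f.
Proof.
apply: ext_eq; rewrite -[RHS]af_map_id; congr (af_map F _ _).
by apply: tens_hom_eq => m; exact: tens_fmap_in.
Qed.

Lemma extension_map_comp (M M' M'' : lmodType R) (w' : {linear M' -> M''})
    (w : {linear M -> M'}) (f : extension M) :
  extension_map (w' \o w) f = extension_map w' (extension_map w f).
Proof.
apply: ext_eq; rewrite /= -af_map_comp; congr (af_map F _ _).
apply: tens_hom_eq => m; rewrite tens_fmap_in.
rewrite -[RHS]/(tens_fmap w' (tens_fmap w (tens_in m))).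
by rewrite !tens_fmap_in.
Qed.
End Extension.

Lemma extension_mor_subproof (R : pzRingType) (F G : rmodfun R) (v : rmodhom F G)
    (M : lmodType R) (f : extension F M) : ext_pred (v (tensralg M) (sval f)).
Proof. by rewrite /ext_pred -!rh_nat (svalP f) rh_act. Qed.

Definition extension_mor (R : pzRingType) (F G : rmodfun R) (v : rmodhom F G)
  (M : lmodType R) : ab_hom (extension F M) (extension G M).
Proof.
exists (fun f => exist _ _ (extension_mor_subproof v f)) => f g.
by apply: ext_eq; exact: rh_add.
Defined.

(* Main.v *)
Require Import Defs.
From mathcomp Require Import all_boot all_algebra.
From HB Require Import structures.
Import GRing.Theory.
Local Open Scope ring_scope.

(** A linear map w : M -> S is the same thing as an R-algebra morphism
    R<M> -> S, and it is also the same thing as an element of M^*(S).  So M^*,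
    as a functor to sets, is represented by R<M>, the universal element being
    the inclusion of M into R<M> ([dual_univP]).  By Yoneda, a morphism of set
    functors from M^* to F is an element f of F(R<M>), which sends w to its
    evaluation F(w~)(f), and it remains to see which f give right linear
    morphisms.

    Compatibility with the right action is tested on a universal case: a linear
    w : M -> S together with a scalar s in S is an R-algebra morphism
    R<M (+) Rx> -> S with x |-> s.  The equation there is F(h_x)(f) = f x, which
    is the condition defining the extension of F ([dual_univ_ext],
    [ext_eval_act]).

    Additivity in w is a further condition, automatic when F(S) = N (x)_R S
    ([ext_evalD]).  Given w1, w2 : M -> S, view the row (w1 w2) as the first row
    of a 2 x 2 matrix, which gives a linear map from M to the algebra of such
    matrices.  Multiplying it on the right by E11, by E21 and by E11 + E21
    yields w1 E11, w2 E11 and (w1 + w2) E11, so compatibility with the right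
    action and additivity of the action in the scalar give
      ev((w1 + w2) E11) = ev(w1 E11) + ev(w2 E11)   in N (x) M_2(S).
    The upper left entry M_2(S) -> S is not a ring morphism, but it is left
    R-linear, hence acts on N (x) _ ; and it sends the value at z in R<M> of the
    algebra morphism extending w E11 to the value of the one extending w.
    Applying it returns the additivity in N (x) S. *)

Set Implicit Arguments.
Unset Strict Implicit.
Unset Printing Implicit Defensive.

(** * The dual as the functor of linear maps *)

Section DualLinear.
Variables (R : pzRingType) (M : lmodType R).
Local Notation Mdual := (dualfun (qcoh_l M)).
Local Notation mtens S := (tens (ralg_r S) M).

(** Evaluation of an element of M^*(S) with its values typed by the ring T and
    its arguments by the tensor product, on which additive maps are determined
    by pure tensors; both are hidden behind [abGroup] in [dual_hom]. *)
Definition dual_app (S : ralg R) (f : Mdual S) (T : ralg S)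
  (x : mtens (ralg_restr T)) : T := (f : dual_hom (qcoh_l M) S) T x.

Lemma dual_appD (S : ralg R) (f : Mdual S) (T : ralg S) x y :
  dual_app f (x + y : mtens (ralg_restr T)) = dual_app f x + dual_app f y.
Proof. exact: (@lh_add _ _ _ (f : dual_hom (qcoh_l M) S) T). Qed.

Lemma dual_app_nmod (S : ralg R) (f : Mdual S) (T : ralg S) :
  nmod_morphism (@dual_app S f T).
Proof.
split; last exact: dual_appD.
exact: (@abD0 (ab_of_zmod _) (ab_of_zmod T) _ (@dual_appD S f T)).
Qed.
HB.instance Definition _ (S : ralg R) (f : Mdual S) (T : ralg S) :=
  GRing.isNmodMorphism.Build (mtens (ralg_restr T)) T (@dual_app S f T)
    (@dual_app_nmod S f T).

Lemma dual_app_act (S : ralg R) (f : Mdual S) (T : ralg S) (s : T) t m :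
  dual_app f (tpure (ralg_lmul (S := ralg_restr T) s t) m)
  = s * dual_app f (tpure t m).
Proof.
have := @lh_act _ _ _ (f : dual_hom (qcoh_l M) S) T s (tpure t m).
by rewrite [lf_act _ _](tens_mapE (ralg_lmul (S := ralg_restr T) s) idfun).
Qed.

Lemma dual_app_nat (S : ralg R) (f : Mdual S) (T T' : ralg S)
    (k : ralg_hom T T') t m :
  dual_app f (tpure (ralg_hom_r (ralg_hom_restr k) t) m)
  = k (dual_app f (tpure t m)).
Proof.
have := @lh_nat _ _ _ (f : dual_hom (qcoh_l M) S) T T' k (tpure t m).
by rewrite [af_map _ _ _](tens_mapE (ralg_hom_r (ralg_hom_restr k)) idfun).
Qed.

Definition ralg_self (S : ralg R) : ralg S := @RAlg S S idfun.

(** M^*(S) = Hom_R(M, S): a morphism of functors on S-algebras is recovered from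
    its value at the initial one. *)
Definition dual_lin (S : ralg R) (f : Mdual S) (m : M) : ralg_l S :=
  dual_app f (@tpure R (ralg_r (ralg_restr (ralg_self S))) M (1 : S) m).

(** T receives a unique S-algebra morphism from S, and t (x) m is t times the
    image of 1 (x) m under it. *)
Lemma dual_app_pure (S : ralg R) (f : Mdual S) (T : ralg S)
    (t : ralg_r (ralg_restr T)) (m : M) :
  dual_app f (tpure t m) = (t : T) * ralg_map T (dual_lin f m).
Proof.
pose k : ralg_hom (ralg_self S) T :=
  @RAlgHom S (ralg_self S) T (ralg_map T) (fun=> erefl).
have := @dual_app_nat S f _ _ k (1 : S) m.
rewrite -[k _]/(ralg_map T (dual_lin f m)) => <-.
rewrite -dual_app_act; congr (dual_app _ (tpure _ _)).
by rewrite /ralg_lmul /ralg_hom_r /= rmorph1 mulr1.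
Qed.

Lemma dual_lin_linear (S : ralg R) (f : Mdual S) : linear (dual_lin f).
Proof.
have [_ hr hZ] := @pure_balanced R (ralg_r (ralg_restr (ralg_self S))) M.
move=> r m m'; rewrite /dual_lin hr dual_appD; congr (_ + _).
by rewrite -hZ dual_app_pure; congr (_ * _); exact: mul1r.
Qed.
HB.instance Definition _ (S : ralg R) (f : Mdual S) :=
  GRing.isLinear.Build R M (ralg_l S) _ (dual_lin f) (dual_lin_linear f).

Lemma dual_lin_inj (S : ralg R) (f g : Mdual S) :
  dual_lin f =1 dual_lin g -> f = g.
Proof.
move=> e; apply: lmodhom_eq => T.
apply: (@tens_ext _ _ _ _ (@dual_app S f T) (@dual_app S g T)) => t m /=.
by rewrite !dual_app_pure e.
Qed.

Section OfLin.
Variables (S : ralg R) (w : {linear M -> ralg_l S}).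

Lemma dual_of_lin_balanced (T : ralg S) :
  balanced (fun (t : ralg_r (ralg_restr T)) (m : M) =>
              (t : T) * ralg_map T (w m)).
Proof.
split=> [t t' m|t m m'|t r m]; first exact: mulrDl.
  by rewrite raddfD rmorphD; exact: mulrDr.
by rewrite linearZ /= rmorphM mulrA.
Qed.

Definition dual_of_lin : Mdual S.
Proof.
apply: (@LModHom S (lmodfun_restr (qcoh_l M) S) (lmodfun_reg S)
  (fun T x => tens_lift (@dual_of_lin_balanced T) x))
  => [T x y|T s x|T T' k x].
- exact: raddfD.
- apply: (@tens_ext R (ralg_r (ralg_restr T)) M T
    (tens_lift (@dual_of_lin_balanced T) \o
       tens_map (ralg_lmul (S := ralg_restr T) s) idfun)
    (s \*o tens_lift (@dual_of_lin_balanced T)) _ x) => t m.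
  rewrite [LHS](congr1 (tens_lift (@dual_of_lin_balanced T)) (tens_mapE _ _ _ _)).
  rewrite tens_liftE [RHS](congr1 ( *%R s) (tens_liftE _ _ _)).
  exact/esym/mulrA.
- apply: (@tens_ext R (ralg_r (ralg_restr T)) M T'
    (tens_lift (@dual_of_lin_balanced T') \o
       tens_map (ralg_hom_r (ralg_hom_restr k)) idfun)
    (k \o tens_lift (@dual_of_lin_balanced T)) _ x) => t m.
  rewrite [LHS](congr1 (tens_lift (@dual_of_lin_balanced T')) (tens_mapE _ _ _ _)).
  rewrite tens_liftE [RHS](congr1 k (tens_liftE _ _ _)).
  by rewrite rmorphM ralg_hom_map.
Defined.

Lemma dual_of_linE : dual_lin dual_of_lin =1 w.
Proof.
move=> m; rewrite [LHS](tens_liftE (@dual_of_lin_balanced (ralg_self S))).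
exact: mul1r.
Qed.
End OfLin.

Lemma dual_lin_act (S : ralg R) (f : Mdual S) (s : S) m :
  dual_lin (rf_act f s) m = ralg_rmul s (dual_lin f m).
Proof. by []. Qed.

(** The left side evaluates f on T as an S-algebra, through an R-algebra structure
    equal but not convertible to that of T; [dual_app_pure], stated for every
    S-algebra, makes the comparison unnecessary. *)
Lemma dual_lin_map (S T : ralg R) (k : ralg_hom S T) (f : Mdual S) m :
  dual_lin (af_map Mdual k f) m = k (dual_lin f m).
Proof.
rewrite [LHS](congr1 (@dual_app S f (ralg_along k (ralg_self T))) (tens_mapE _ _ _ _)).
by rewrite dual_app_pure; exact: mul1r.
Qed.

End DualLinear.

Lemma dual_lin_mor (R : pzRingType) (M M' : lmodType R) (w : {linear M -> M'})
    (S : ralg R) (f : dualfun (qcoh_l M') S) m :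
  dual_lin (dual_mor (qcoh_l_mor w) S f) m = dual_lin f (w m).
Proof.
by rewrite [LHS](congr1 (@dual_app _ _ S f (ralg_self S)) (tens_mapE idfun w _ _)).
Qed.

(** * Representability of the dual by the tensor algebra *)

Section Yoneda.
Variables (R : pzRingType) (M : lmodType R).
Local Notation Mdual := (dualfun (qcoh_l M)).

Definition dual_univ : Mdual (tensralg M) := dual_of_lin (@tens_in R M).

Lemma dual_univE m : dual_lin dual_univ m = tens_in m.
Proof. exact: dual_of_linE. Qed.

Lemma dual_univP (S : ralg R) (f : Mdual S) :
  af_map Mdual (tens_ext_hom (dual_lin f)) dual_univ = f.
Proof.
apply: dual_lin_inj => m.
by rewrite dual_lin_map dual_univE; exact: tens_ext_homE.
Qed.

Variable F : rmodfun R.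

(** Both h_x and right multiplication by x take the image of the universal
    element in M^*(R<M (+) Rx>) to the linear map m |-> m x. *)
Lemma dual_univ_ext (f : rmodhom Mdual F) : ext_pred (f _ dual_univ).
Proof.
rewrite /ext_pred -!rh_nat -rh_act; congr (f _ _); apply: dual_lin_inj => m.
rewrite dual_lin_act !dual_lin_map dual_univE.
by rewrite [X in tens_hx M X]tens_fmap_in [X in ralg_rmul _ X]tens_fmap_in tens_hx_in.
Qed.

Definition eval_univ : ab_hom (rmodhom_ab Mdual F) (extension F M) :=
  @AbHom (rmodhom_ab Mdual F) (extension F M)
    (fun f => exist _ _ (dual_univ_ext f))
    (fun f g => @ext_eq R F M (exist _ _ (dual_univ_ext (rh_sum f g)))
                (ab_add (exist _ _ (dual_univ_ext f) : extension F M)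
                (exist _ _ (dual_univ_ext g))) erefl).

Lemma eval_univ_inj : injective eval_univ.
Proof.
move=> f g e; apply: rmodhom_eq => S x.
by rewrite -[x]dual_univP !rh_nat; congr (af_map _ _ _); exact: (congr1 sval e).
Qed.

Definition ext_eval (f : extension F M) (S : ralg R)
  (w : {linear M -> ralg_l S}) : F S := af_map F (tens_ext_hom w) (sval f).

Lemma ext_eval_eq (f : extension F M) (S : ralg R)
    (w w' : {linear M -> ralg_l S}) : w =1 w' -> ext_eval f w = ext_eval f w'.
Proof.
move=> e; rewrite /ext_eval; congr (af_map F _ _); apply: tens_hom_eq => m.
by rewrite !tens_ext_homE.
Qed.

Lemma ext_eval_nat (f : extension F M) (S T : ralg R) (k : ralg_hom S T)
    (w : {linear M -> ralg_l S}) :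
  ext_eval f (ralg_hom_l k \o w) = af_map F k (ext_eval f w).
Proof.
rewrite /ext_eval -af_map_comp; congr (af_map F _ _); apply: tens_hom_eq => m.
rewrite tens_ext_homE; exact/esym/(congr1 k)/tens_ext_homE.
Qed.

(** The equation F(h_x)(f) = f x, transported along the morphism
    R<M (+) Rx> -> S that is w on M and sends x to s. *)
Lemma ext_eval_act (f : extension F M) (S : ralg R)
    (w : {linear M -> ralg_l S}) (s : S) :
  ext_eval f (ralg_rmul s \o w) = rf_act (ext_eval f w) s.
Proof.
pose k_lin (p : M * R^o) : ralg_l S := w p.1 + (p.2 : R) *: (s : ralg_l S).
have k_linear : linear k_lin.
  move=> r [m a] [m' a']; rewrite /k_lin /= linearP scalerDl -scalerA scalerDr.
  exact: addrACA.
pose k := tens_ext_hom (HB.pack k_lin (GRing.isLinear.Build R _ (ralg_l S) _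
  k_lin k_linear) : {linear (M * R^o)%type -> ralg_l S}).
have k_in m : k (tens_in (inj_l m)) = w m.
  by rewrite /k tens_ext_homE /= /k_lin /= scale0r addr0.
have k_gen : k (tens_gen M) = s.
  by rewrite /k tens_ext_homE /= /k_lin /= linear0 scale1r add0r.
have -> : ext_eval f w
  = af_map F k (af_map F (tens_fmap (@inj_l R M)) (sval f)).
  rewrite -af_map_comp; congr (af_map F _ _); apply: tens_hom_eq => m.
  rewrite tens_ext_homE -k_in.
  exact/esym/(congr1 k)/tens_fmap_in.
rewrite -[in RHS]k_gen -rf_act_map -(svalP f) -!af_map_comp; congr (af_map F _ _).
apply: tens_hom_eq => m; rewrite tens_ext_homE.
rewrite [RHS](congr1 (fun z => k (tens_hx M z)) (tens_fmap_in _ _)).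
by rewrite [X in k X]tens_hx_in rmorphM /= k_in k_gen.
Qed.
End Yoneda.
Arguments eval_univ {R M} F.

(** The transpose of w : M -> M' and the algebra morphism R<M> -> R<M'> both take
    the universal element to the linear map w into R<M'>. *)
Lemma eval_univ_nat (R : pzRingType) (F : rmodfun R) (M M' : lmodType R)
    (w : {linear M -> M'}) (f : rmodhom (dualfun (qcoh_l M)) F) :
  eval_univ F (rmodhom_comp f (dual_mor (qcoh_l_mor w)))
  = extension_map F w (eval_univ F f).
Proof.
apply: ext_eq.
rewrite -[LHS]/(f _ (dual_mor (qcoh_l_mor w) _ (dual_univ M'))).
rewrite -[RHS]/(af_map F (tens_fmap w) (f _ (dual_univ M))) -rh_nat.
congr (f _ _); apply: dual_lin_inj => m.
rewrite dual_lin_map dual_lin_mor !dual_univE; exact/esym/tens_fmap_in.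
Qed.

(** * Additivity through two by two matrices *)

Section Matrices.
Variables (R : pzRingType) (S : ralg R).

Definition mx2_ralg : ralg R :=
  @RAlg R 'M[S]_2 (@scalar_mx S 2 \o ralg_map S).

Definition row2 (a b : S) : 'M[S]_2 :=
  \matrix_(i, j) if i == 0 then (if j == 0 then a else b) else 0.

Definition col2 (a b : S) : 'M[S]_2 :=
  \matrix_(i, j) if j == 0 then (if i == 0 then a else b) else 0.

Lemma row2M (a b c d : S) : row2 a b * col2 c d = row2 (a * c + b * d) 0.
Proof.
apply/matrixP => i j; rewrite !mxE !big_ord_recr big_ord0 /= !mxE /=.
by case: (i == 0); case: (j == 0); rewrite ?mul0r ?mulr0 ?addr0 ?add0r.
Qed.

Lemma col2D (a b c d : S) : col2 a b + col2 c d = col2 (a + c) (b + d).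
Proof.
by apply/matrixP => i j; rewrite !mxE; case: (j == 0); case: (i == 0); rewrite ?addr0.
Qed.

Lemma mx2_scaleE (r : R) (A : ralg_l mx2_ralg) :
  r *: A = ralg_map S r *: (A : 'M[S]_2).
Proof. exact: mul_scalar_mx. Qed.

Definition mx2_entry (A : ralg_l mx2_ralg) : ralg_l S := (A : 'M[S]_2) 0 0.
Lemma mx2_entry_linear : linear mx2_entry.
Proof. by move=> r A B; rewrite /mx2_entry mx2_scaleE !mxE. Qed.
HB.instance Definition _ := GRing.isLinear.Build R (ralg_l mx2_ralg) (ralg_l S) _
  mx2_entry mx2_entry_linear.

Variable M : lmodType R.

Definition row2_lin (w1 w2 : {linear M -> ralg_l S}) (m : M) : ralg_l mx2_ralg :=
  row2 (w1 m) (w2 m).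
Lemma row2_lin_linear w1 w2 : linear (row2_lin w1 w2).
Proof.
move=> r m m'; rewrite mx2_scaleE; apply/matrixP => i j.
rewrite !mxE !linearP.
by case: (i == 0); case: (j == 0); rewrite //= mulr0 addr0.
Qed.
HB.instance Definition _ w1 w2 := GRing.isLinear.Build R M (ralg_l mx2_ralg) _
  (row2_lin w1 w2) (row2_lin_linear w1 w2).

(** Although [mx2_entry] is not multiplicative on all matrices, it is on products
    whose left factor is supported at the upper left entry.  The scalar part is
    preserved as well, R acting through scalar matrices. *)
Lemma mx2_entry_hom (w : {linear M -> ralg_l S}) (z : tensralg M) :
  mx2_entry (tens_ext_hom (row2_lin w \0) z) = tens_ext_hom w z.
Proof.
apply: (@tensalg_ext R M S (mx2_entry \o tens_ext_hom (row2_lin w \0))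
  (tens_ext_hom w)) => u r.
rewrite /= !tens_evalE /word_eval /mx2_entry.
elim: u => [|m u IH]; first by rewrite !big_nil !mul1r mxE.
rewrite !big_cons -!mulrA -IH mxE !big_ord_recr big_ord0 /=.
rewrite ![row2_lin _ _ _ _ _]mxE /= mul0r add0r addr0.
by rewrite (_ : widen_ord _ _ = 0) //; exact: val_inj.
Qed.

Variable N : lmodType R^c.
Variable f : extension (qcoh_r N) M.

Lemma ext_eval_corner (w : {linear M -> ralg_l S}) :
  tens_map (idfun : {linear N -> N}) mx2_entry (ext_eval f (row2_lin w \0))
  = ext_eval f w.
Proof. by apply: tens_map_compE => // z; exact: mx2_entry_hom. Qed.

(** For a general F the corresponding identity holds in F(M_2(S)); descending to
    F(S) uses that N (x) _ is functorial in mere R-linear maps. *)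
Lemma ext_evalD (w1 w2 : {linear M -> ralg_l S}) :
  ext_eval f (w1 \+ w2) = ab_add (ext_eval f w1) (ext_eval f w2).
Proof.
have act (w : {linear M -> ralg_l S}) (c1 c2 : S) :
    (forall m, (w1 m : S) * c1 + (w2 m : S) * c2 = w m) ->
    rf_act (ext_eval f (row2_lin w1 w2)) (col2 c1 c2)
    = ext_eval f (row2_lin w \0).
  move=> h; rewrite -ext_eval_act; apply: ext_eval_eq => m.
  by rewrite /= /row2_lin -h; exact: row2M.
rewrite -!ext_eval_corner -(act _ 1 1) => [|m]; last by rewrite !mulr1.
rewrite -(act w1 1 0) => [|m]; last by rewrite mulr1 mulr0 addr0.
rewrite -(act w2 0 1) => [|m]; last by rewrite mulr1 mulr0 add0r.
have -> : col2 1 1 = col2 1 0 + col2 0 1 by rewrite col2D addr0 add0r.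
by rewrite (@rf_actDr _ (qcoh_r N) mx2_ralg); exact: raddfD.
Qed.
End Matrices.

(** * The isomorphism *)

Section Inverse.
Variables (R : pzRingType) (M : lmodType R) (N : lmodType R^c).
Local Notation Mdual := (dualfun (qcoh_l M)).

Definition ext_rmodhom (f : extension (qcoh_r N) M) : rmodhom Mdual (qcoh_r N).
Proof.
apply: (@RModHom R Mdual (qcoh_r N) (fun S x => ext_eval f (dual_lin x))).
- move=> S x y; rewrite -ext_evalD; exact: ext_eval_eq.
- move=> S x s; rewrite -ext_eval_act; exact: ext_eval_eq.
- move=> S T k x; rewrite -ext_eval_nat; apply: ext_eval_eq.
  exact: dual_lin_map.
Defined.

Lemma ext_rmodhomK : cancel ext_rmodhom (eval_univ (qcoh_r N)).
Proof.
move=> f; apply: ext_eq; rewrite -[RHS]af_map_id.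
rewrite -[LHS]/(ext_eval f (dual_lin (dual_univ M))) /ext_eval.
congr (ab_fun (af_map _ _) _); apply: tens_hom_eq => m.
rewrite tens_ext_homE; exact: dual_univE.
Qed.

Lemma eval_univ_bij : bijective (@eval_univ R M (qcoh_r N)).
Proof.
exists ext_rmodhom; last exact: ext_rmodhomK.
by move=> f; apply: eval_univ_inj; rewrite ext_rmodhomK.
Qed.
End Inverse.

Theorem theorem5p1 (R : pzRingType) :
  exists Phi : forall (M : lmodType R) (N : lmodType R^c),
      ab_hom (rmodhom_ab (dualfun (qcoh_l M)) (qcoh_r N))
             (extension (qcoh_r N) M),
    [/\ (forall (M : lmodType R) (N : lmodType R^c), bijective (Phi M N)),
        (forall (M M' : lmodType R) (N : lmodType R^c) (w : {linear M -> M'})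
                (f : rmodhom (dualfun (qcoh_l M)) (qcoh_r N)),
           Phi M' N (rmodhom_comp f (dual_mor (qcoh_l_mor w))) =
           extension_map (qcoh_r N) w (Phi M N f))
      & (forall (M : lmodType R) (N N' : lmodType R^c) (v : {linear N -> N'})
                (f : rmodhom (dualfun (qcoh_l M)) (qcoh_r N)),
           Phi M N' (rmodhom_comp (qcoh_r_mor v) f) =
           extension_mor (qcoh_r_mor v) M (Phi M N f))].
Proof.
exists (fun M N => @eval_univ R M (qcoh_r N)); split=> [M N|M M' N w f|M N N' v f].
- exact: eval_univ_bij.
- exact: eval_univ_nat.
- exact: ext_eq.
Qed.
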